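(* Let $F$ be a distribution on $\mathbb{R}$ with a density, and let $X, X_1, X_2,\ldots$ be i.i.d. with distribution $F$ and mean $\mu$. Suppose $\bar F(x)=1-F(x)=L(x)x^{-\alpha}$ for a slowly varying $L$ and $\alpha>2$, and $E|X|^{2+\delta}<\infty$ for some $\delta>0$. Let $\gamma=\gamma(n)=n\mu+\omega(\sqrt{n\log n})$ and let $u=u(n)\le \mu+O\big((\gamma-n\mu)/\sqrt{\log n}\big)$. Then, as $n\to\infty$, $$\tilde p(\tilde F_u)-\tilde p(F) = -\tilde p(F)(1+o(1)).$$
   Context: $S_n=X_1+\cdots+X_n$. For a distribution $G$, $\tilde p(G)=P_G(S_n\ge\gamma)$ is the probability that $S_n\ge\gamma$ when $X_1,\ldots,X_n$ are i.i.d. with law $G$. The truncated distribution $\tilde F_u$ is $\tilde F_u(x)=F(x)/F(u)$ for $x\le u$ and $1$ for $x>u$. $a_n=o(b_n)$: $a_n/b_n\to0$; $a_n=\omega(b_n)$: $a_n/b_n\to\infty$; $a_n=O(b_n)$: $|a_n/b_n|$ bounded for large $n$. *)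

(* Defs.v *)
From HB Require Import structures.
From mathcomp Require Import all_boot all_order all_algebra.
From mathcomp Require Import all_classical all_reals all_analysis.
Set Implicit Arguments. Unset Strict Implicit. Unset Printing Implicit Defensive.
Import Order.TTheory GRing.Theory Num.Theory.
Import numFieldNormedType.Exports.
Local Open Scope classical_set_scope.
Local Open Scope ring_scope.

(* Iterated integral computing P(x_1 + ... + x_k + s >= g) when the x_i are
   i.i.d. with law  A |-> mu (A `&` D) / c.
   tailI mu D c g k s
     = c^-k * \int[mu]_(x1 in D) ... \int[mu]_(xk in D) 1{ s + x1 + ... + xk >= g }. *)
Fixpoint tailI (R : realType) (mu : {measure set R -> \bar R}) (D : set R)
    (c g : R) (k : nat) (s : R) : \bar R :=
  match k with
  | 0 => (if (g <= s)%R then 1 else 0)%:E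
  | k'.+1 => ((c^-1)%:E * \int[mu]_(x in D) tailI mu D c g k' (s + x))%E
  end.

(* ptilde mu g n = P_G(S_n >= g) for X_1..X_n i.i.d. with law G = mu *)
Definition ptilde (R : realType) (mu : {measure set R -> \bar R}) (g : R) (n : nat) : R :=
  fine (tailI mu setT 1 g n 0).

(* ptilde of the truncated law  tilde F_u (x) = F(x)/F(u) for x <= u, 1 for x > u,
   i.e. the law A |-> mu (A `&` ]-oo,u]) / mu ]-oo,u]. *)
Definition ptilde_trunc (R : realType) (mu : {measure set R -> \bar R}) (u g : R)
    (n : nat) : R :=
  fine (tailI mu `]-oo, u]%classic (fine (mu `]-oo, u]%classic)) g n 0).

Definition distrF (R : realType) (mu : {measure set R -> \bar R}) (x : R) : R :=
  fine (mu `]-oo, x]%classic).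
Definition tailF (R : realType) (mu : {measure set R -> \bar R}) (x : R) : R :=
  1 - distrF mu x.

Definition slowly_varying (R : realType) (L : R -> R) : Prop :=
  (\forall x \near +oo, 0 < L x) /\
  forall lam : R, 0 < lam -> (fun x => L (lam * x) / L x) @ +oo --> (1 : R).

(* Main.v *)
Require Import Defs.
From HB Require Import structures.
From mathcomp Require Import all_boot all_order all_algebra.
From mathcomp Require Import all_classical all_reals all_analysis.
From mathcomp Require Import measurable_realfun.
From mathcomp Require Import ring lra.
Import Order.TTheory GRing.Theory Num.Theory.
Import numFieldNormedType.Exports.
Local Open Scope classical_set_scope.
Local Open Scope ring_scope.

(** Put [x = gamma n - n mu] and [l = ln x].  An exponential Markov inequality
    at [th = A l / x] for the truncated law bounds [ptilde_trunc] by
    [expR (- A l + n B)]: for [th (y - mu) <= 1/2] the exponential is dominated by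
    a quadratic, and beyond that range, where [y <= u], by
    [expR (th (u - mu)) (4 th |y|)^(2 + delta)]; the bounds
    [x >> sqrt (n ln n)] and [th (u - mu) = O (l / sqrt (ln n))] then give
    [n B <= l].  Conversely the event that a single summand exceeds its mean
    by [2 x], while by Chebyshev's inequality the others do not fall [x] below
    theirs, gives [ptilde >= tailF (3 x) / 2], which regular variation bounds
    below by a constant times [x^-m].  Taking [A = m + 2] yields the ratio
    [O (1 / x)]. *)

(** * Iterated tail integrals: monotonicity and the exponential Markov bound *)

Lemma nondecreasing_emeasurable (R : realType) (D : set R) (f : R -> \bar R) :
  measurable D -> (forall x, f x \is a fin_num) ->
  {homo f : x y / (x <= y)%R >-> (x <= y)%E} -> measurable_fun D f.
Proof.
move=> mD ffin fnd.
have -> : f = EFin \o (fine \o f) by apply/funext => x /=; rewrite fineK.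
apply/measurable_EFinP; apply: nondecreasing_measurable => // x y xy.
by rewrite -lee_fin /= !fineK// fnd.
Qed.

(** The two claims need one joint induction: monotonicity in [s] and finiteness make the inner
    integrand measurable, and measurability is what lets the next integral be compared. *)
Lemma tailI_bounds (R : realType) (F : {measure set R -> \bar R}) (D : set R) (c g : R) k :
  measurable D -> 0 < c -> F D = c%:E ->
  (forall s, (0 <= tailI F D c g k s <= 1)%E) /\
  {homo tailI F D c g k : s t / (s <= t)%R >-> (s <= t)%E}.
Proof.
move=> mD c0 FD; elim: k => [|k [b m]] /=.
  split=> [s|s t st]; first by case: ifP; rewrite !lee_fin ?lexx ler01.
  case: ifP => [gs|_]; first by rewrite (le_trans gs st).
  by case: ifP; rewrite lee_fin.
have fin s : tailI F D c g k s \is a fin_num.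
  have /andP[h0 h1] := b s; rewrite fin_numE -ltNye -ltey.
  by rewrite (lt_le_trans _ h0)?ltNyr// (le_lt_trans h1)// ltry.
have mf s : measurable_fun D (fun x => tailI F D c g k (s + x)).
  apply: nondecreasing_emeasurable => // x y xy.
  by apply: m; rewrite lerD2l.
have ci : (0 <= (c^-1)%:E)%E by rewrite lee_fin invr_ge0 ltW.
split=> [s|s t st].
  apply/andP; split.
    by apply: mule_ge0 => //; apply: integral_ge0 => x _; case/andP: (b (s + x)).
  have -> : (1 = (c^-1)%:E * c%:E :> \bar R)%E by rewrite -EFinM mulVf// gt_eqF.
  apply: lee_wpmul2l => //.
  have -> : (c%:E = \int[F]_(x in D) cst 1 x :> \bar R)%E.
    by rewrite integral_cst// FD mul1e.
  apply: ge0_le_integral => // x _; first by case/andP: (b (s + x)).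
  by case/andP: (b (s + x)).
apply: lee_wpmul2l => //; apply: ge0_le_integral => // x _.
- by case/andP: (b (s + x)).
- by apply: m; rewrite lerD2r.
Qed.

Section iterated_tail.
Context {R : realType} (F : {measure set R -> \bar R}) (D : set R) (c g : R).
Hypotheses (mD : measurable D) (c0 : 0 < c) (FD : F D = c%:E).

Lemma tailI_ge0 k s : (0 <= tailI F D c g k s)%E.
Proof. by have [/(_ s)/andP[]] := tailI_bounds _ _ _ _ g k mD c0 FD. Qed.

Lemma tailI_le1 k s : (tailI F D c g k s <= 1)%E.
Proof. by have [/(_ s)/andP[]] := tailI_bounds _ _ _ _ g k mD c0 FD. Qed.

Lemma tailI_homo k s t : s <= t -> (tailI F D c g k s <= tailI F D c g k t)%E.
Proof. by have [_ h] := tailI_bounds _ _ _ _ g k mD c0 FD; exact: h. Qed.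

Lemma tailI_fin_num k s : tailI F D c g k s \is a fin_num.
Proof.
rewrite fin_numE -ltNye -ltey (lt_le_trans _ (tailI_ge0 k s)) ?ltNyr//.
by rewrite (le_lt_trans (tailI_le1 k s))// ltry.
Qed.

Lemma measurable_tailI k s : measurable_fun D (fun x => tailI F D c g k (s + x)).
Proof.
apply: nondecreasing_emeasurable => // [x|x y xy]; first exact: tailI_fin_num.
by apply: tailI_homo; rewrite lerD2l.
Qed.

(** Markov's inequality, level by level: the indicator of [g <= s] is at most [expR (th * (s - g))],
    and each normalised integration costs at most a factor [M]. *)
Lemma tailI_le_expR (th M : R) : 0 < th -> 0 <= M ->
    (\int[F]_(x in D) (expR (th * x))%:E <= (M * c)%:E)%E ->
  forall k s, (tailI F D c g k s <= (expR (th * (s - g)) * M ^+ k)%:E)%E.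
Proof.
move=> th0 M0 HM; elim => [|k IH] s /=.
  rewrite expr0 mulr1 lee_fin; case: ifPn => [gs|_]; last exact: expR_ge0.
  by rewrite -(expR0) ler_expR mulr_ge0 ?subr_ge0// ltW.
have me : measurable_fun D (fun x : R => (expR (th * x))%:E).
  apply/measurable_EFinP; apply: (@measurable_funTS _ _ _ _ D).
  by apply: measurableT_comp => //; exact: measurable_funM.
have h : (\int[F]_(x in D) tailI F D c g k (s + x) <=
    (expR (th * (s - g)) * M ^+ k)%:E * \int[F]_(x in D) (expR (th * x))%:E)%E.
  rewrite -ge0_integralZl_EFin//; last first.
    by rewrite mulr_ge0 ?expR_ge0 ?exprn_ge0.
  apply: ge0_le_integral => //.
  - by move=> x _; exact: tailI_ge0.
  - exact: measurable_tailI.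
  - exact: measurable_funeM.
  - move=> x _; apply: (le_trans (IH _)); rewrite -EFinM lee_fin mulrAC -expRD.
    by rewrite -mulrDr addrAC.
apply: (@le_trans _ _ ((c^-1)%:E * ((expR (th * (s - g)) * M ^+ k)%:E * (M * c)%:E))%E).
  apply: lee_wpmul2l; first by rewrite lee_fin invr_ge0 ltW.
  apply: (le_trans h); apply: lee_wpmul2l => //.
  by rewrite lee_fin mulr_ge0 ?expR_ge0 ?exprn_ge0.
rewrite -!EFinM lee_fin exprSr [leLHS](_ : _ = expR (th * (s - g)) * (M ^+ k * M))//.
by field; rewrite gt_eqF.
Qed.

End iterated_tail.

(** * Second moments: Chebyshev's inequality and one big jump *)

Section moments.
Context {R : realType} (F : {measure set R -> \bar R}) (mu s2 : R).
Hypotheses (FT : F setT = 1%E).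
Hypothesis iX : F.-integrable setT (fun x : R => x%:E).
Hypothesis EX : (\int[F]_x x%:E = mu%:E)%E.
Hypothesis iX2 : F.-integrable setT (fun x : R => ((x - mu) ^+ 2)%:E).
Hypothesis EX2 : (\int[F]_x ((x - mu) ^+ 2)%:E = s2%:E)%E.

Lemma integrable_cstT (r : R) : F.-integrable setT (fun=> r%:E).
Proof.
apply/integrableP; split; first exact: measurable_cst.
by rewrite (integral_cst F measurableT) FT mule1 ltry.
Qed.

Lemma integrable_quadratic (p q r : R) :
  F.-integrable setT (fun x => (p + q * (x - mu) + r * (x - mu) ^+ 2)%:E).
Proof.
have -> : (fun x : R => (p + q * (x - mu) + r * (x - mu) ^+ 2)%:E) =
  (fun x => ((p - q * mu)%:E + q%:E * x%:E) + r%:E * ((x - mu) ^+ 2)%:E)%E.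
  by apply/funext => x; rewrite -!EFinM -!EFinD; congr (_%:E); ring.
apply: integrableD => //; last exact: integrableZl.
by apply: integrableD => //; [exact: integrable_cstT|exact: integrableZl].
Qed.

Lemma integral_quadratic (p q r : R) :
  (\int[F]_x (p + q * (x - mu) + r * (x - mu) ^+ 2)%:E = (p + r * s2)%:E)%E.
Proof.
have -> : (fun x : R => (p + q * (x - mu) + r * (x - mu) ^+ 2)%:E) =
  (fun x => ((p - q * mu)%:E + q%:E * x%:E) + r%:E * ((x - mu) ^+ 2)%:E)%E.
  by apply/funext => x; rewrite -!EFinM -!EFinD; congr (_%:E); ring.
have i1 := integrable_cstT (p - q * mu).
have i2 := integrableZl measurableT q iX.
have i3 := integrableZl measurableT r iX2.
rewrite integralD//; last exact: integrableD.
rewrite integralD// !integralZl// EX EX2 (integral_cst F measurableT) FT mule1.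
by rewrite -!EFinM -!EFinD; congr (_%:E); ring.
Qed.

(* A one-sided Chebyshev bound in the form that the recursion of [tailI]
   preserves: the indicator of [g <= t] dominates the concave parabola
   [1 - (t - g - y)^2 / y^2], whose expectation is explicit. *)
Lemma tailI_ge_quadratic (g y : R) : 0 < y -> forall k s,
  ((1 - ((s - g + k%:R * mu - y) ^+ 2 + k%:R * s2) / y ^+ 2)%:E
    <= tailI F setT 1 g k s)%E.
Proof.
move=> y0; have y2 : 0 < y ^+ 2 by rewrite exprn_gt0.
elim => [|k IH] s /=.
  rewrite !mul0r !addr0 lee_fin; case: ifPn => [gs|].
    by rewrite gerBl mulr_ge0 ?invr_ge0 ?sqr_ge0 ?(ltW y2).
  rewrite -ltNge => sg; rewrite subr_le0 ler_pdivlMr// mul1r.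
  have : 0 <= (s - g) * (s - g - 2 * y) by rewrite mulr_le0//; lra.
  by lra.
rewrite invr1 mul1e.
(* After integrating out [x], the induction hypothesis has its square at [a + (x - mu)]. The cross
   term has mean zero and [(x - mu) ^+ 2] supplies one more [s2]. *)
pose a := s - g + k.+1%:R * mu - y.
have -> : 1 - (a ^+ 2 + k.+1%:R * s2) / y ^+ 2 =
   (1 - (a ^+ 2 + k%:R * s2) / y ^+ 2) + (- (y ^+ 2)^-1) * s2.
  by rewrite -natr1; field; rewrite gt_eqF.
rewrite -(integral_quadratic _ (- (2 * a) / y ^+ 2)).
apply: le_integral => //; first exact: integrable_quadratic.
  apply/integrableP; split.
    by apply: measurable_tailI => //; rewrite FT.
  apply: (@le_lt_trans _ _ (\int[F]_x cst 1 x)%E); last first.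
    by rewrite (integral_cst F measurableT) FT mule1 ltry.
  apply: ge0_le_integral => //.
  - by apply: measurableT_comp => //; apply: measurable_tailI; rewrite // FT.
  - by move=> x _; rewrite gee0_abs ?tailI_ge0 ?tailI_le1//= FT.
move=> x _; apply: le_trans (IH _); rewrite lee_fin le_eqVlt; apply/orP; left.
by apply/eqP; rewrite /a -natr1; field; rewrite gt_eqF.
Qed.

Lemma variance_ge0 : 0 <= s2.
Proof.
by rewrite -lee_fin -EX2; apply: integral_ge0 => x _; rewrite lee_fin sqr_ge0.
Qed.

(** The first summand is restricted to values so large that the other [n] may fall short of their
    mean by [y]; Chebyshev bounds the probability that they fall further. *)
Lemma tailI_ge_one_big_jump (g y : R) n : 0 < y -> n%:R * s2 <= y ^+ 2 ->
  ((1 - n%:R * s2 / y ^+ 2)%:E * F `](g - n%:R * mu + y)%R, +oo[%classic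
    <= tailI F setT 1 g n.+1 0)%E.
Proof.
move=> y0 ny /=; rewrite invr1 mul1e.
set D := [set` _].
have mD : measurable D by exact: measurable_itv.
have mt : measurable_fun setT (fun x : R => tailI F setT 1 g n (0 + x)).
  by apply: measurable_tailI; rewrite // FT.
apply: (@le_trans _ _ (\int[F]_(x in D) tailI F setT 1 g n (0 + x))%E); last first.
  by apply: ge0_subset_integral => // x _; rewrite tailI_ge0// FT.
rewrite -(integral_cst F mD); apply: ge0_le_integral => //.
- move=> x _; rewrite lee_fin subr_ge0 ler_pdivrMr ?mul1r//.
  by rewrite exprn_gt0.
- exact: measurable_funTS.
move=> x; rewrite /D /= in_itv /= andbT => xt; rewrite add0r.
(* [y'] is the actual slack given the jump [x]; taking it as the width of the parabola makes the
   squared term vanish. *)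
pose y' := x - g + n%:R * mu.
have yy' : y < y' by rewrite /y'; lra.
have y'0 : 0 < y' by apply: lt_trans yy'.
apply: le_trans (tailI_ge_quadratic g _ y'0 n x); rewrite lee_fin.
rewrite -/y' subrr expr0n/= add0r lerD2l lerN2.
apply: ler_wpM2l; first by rewrite mulr_ge0 ?variance_ge0.
rewrite lef_pV2 ?posrE ?exprn_gt0// lerXn2r ?nnegrE ?(ltW y0) ?(ltW y'0)//.
exact: ltW.
Qed.

(** Otherwise [x - mu] would be almost surely nonnegative with mean zero, yet at least [1] on a set
    of positive measure. The positive mass at or below [mu] later bounds the normalising constant of
    the truncated law from below. *)
Lemma below_mean_gt0 : (0 < F `](mu + 1)%R, +oo[%classic)%E ->
  (0 < F `]-oo, mu]%classic)%E.
Proof.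
move=> Fp; rewrite lt0e measure_ge0 andbT; apply/eqP => F0.
pose f (x : R) := (0 + 1 * (x - mu) + 0 * (x - mu) ^+ 2)%:E.
have fi : F.-integrable setT f by exact: integrable_quadratic.
have := integral_quadratic 0 1 0; rewrite -/f mul0r addr0.
have fE : f = fun x => (x - mu)%:E.
  by apply/funext => x; rewrite /f add0r mul1r mul0r addr0.
pose D := `]-oo, mu]%classic : set R.
have mD : measurable D by exact: measurable_itv.
have mDC : measurable (~` D) by exact: measurableC.
rewrite -(setUv D) integral_setU//; last 2 first.
- by rewrite setUv; move/integrableP : fi => [].
- by rewrite disj_set2E setICr.
rewrite null_set_integral//; last exact: measurable_funTS (measurable_int _ fi).
rewrite add0e => h.
have : (F `](mu + 1)%R, +oo[%classic <= 0)%E.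
  rewrite (_ : 0%E = 0%:E)// -h.
  have mE : measurable (`](mu + 1)%R, +oo[%classic : set R) by exact: measurable_itv.
  apply: (@le_trans _ _ (\int[F]_(x in `](mu + 1)%R, +oo[%classic) f x)%E).
    rewrite -[leLHS]mul1e -(integral_cst F mE); apply: ge0_le_integral => //.
    + exact: measurable_funTS (measurable_int _ fi).
    + by move=> x; rewrite /= in_itv /= andbT fE lee_fin => hx; lra.
  apply: ge0_subset_integral => //.
  + exact: measurable_funTS (measurable_int _ fi).
  + by move=> x; rewrite /D /= in_itv /= fE lee_fin => /negP; rewrite -ltNge => hx; lra.
  + move=> x; rewrite /D /= !in_itv /= andbT => hx; apply/negP; rewrite -ltNge; lra.
by rewrite leNgt Fp.
Qed.

End moments.

(** * Exponential moment of the truncated law *)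

(** Since [expR (- z) >= 1 - z], it suffices that the quadratic times [1 - z], which is
    [1 + z^2 (1 - 2 z)], is at least [1]. *)
Lemma expR_le_quadratic (R : realType) (z : R) :
  z <= 1 / 2 -> expR z <= 1 + z + 2 * z ^+ 2.
Proof.
move=> z2.
have h : 1 - z <= (expR z)^-1 by rewrite -expRN; exact: expR_ge1Dx.
have z1 : 0 < 1 - z by lra.
have e0 := expR_gt0 z.
have : expR z * (1 - z) <= 1 by rewrite mulrC -ler_pdivlMr// div1r.
have p : 1 <= (1 + z + 2 * z ^+ 2) * (1 - z).
  rewrite (_ : _ * _ = 1 + z ^+ 2 * (1 - 2 * z)); last by ring.
  by rewrite lerDl mulr_ge0 ?sqr_ge0//; lra.
by move=> h1; rewrite -(ler_pM2r z1); apply: le_trans p.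
Qed.

Lemma expR_trunc_le (R : realType) (th q V mu x : R) :
  0 < th -> 0 < q -> th * `|mu| <= 1 / 4 -> th * (x - mu) <= V ->
  expR (th * (x - mu)) <= 1 + th * (x - mu) + 2 * th ^+ 2 * (x - mu) ^+ 2 +
    expR V * (4 * th) `^ q * (`|x| `^ q).
Proof.
move=> th0 q0 hmu hV; set z := th * (x - mu).
rewrite -[2 * _ * _]mulrA -exprMn -/z.
have [z2|z2] := leP z (1 / 2).
  apply: (le_trans (expR_le_quadratic _ _ z2)).
  by rewrite lerDl !mulr_ge0 ?expR_ge0 ?powR_ge0.
(* The centring shifts [th * x] by at most [1 / 4], so [z > 1 / 2] forces [th * x > 1 / 4]; the
   power of [4 * th * |x|] is then at least [1]. *)
have h : 1 <= (4 * th) * `|x|.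
  have := ler_norm x; have := ler_norm (- mu); rewrite normrN => h1 h2.
  have h3 : th * - mu <= th * `|mu| by rewrite ler_pM2l.
  have h4 : th * x <= th * `|x| by rewrite ler_pM2l.
  by rewrite /z in z2; lra.
apply: (@le_trans _ _ (expR V * (4 * th) `^ q * `|x| `^ q)); last first.
  by rewrite lerDr; have := sqr_ge0 z; lra.
have th4 : 0 <= 4 * th by rewrite mulr_ge0// ltW.
rewrite -mulrA -powRM//.
apply: (@le_trans _ _ (expR V)); first by rewrite ler_expR.
rewrite ler_peMr ?expR_ge0// [leLHS](_ : 1 = 1 `^ q); last by rewrite powR1.
by apply: ge0_ler_powR; rewrite ?nnegrE ?(ltW q0) ?(mulr_ge0 th4).
Qed.

Section truncated_mgf.
Context {R : realType} (F : {measure set R -> \bar R}) (mu s2 q m : R).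
Hypotheses (FT : F setT = 1%E).
Hypothesis iX : F.-integrable setT (fun x : R => x%:E).
Hypothesis EX : (\int[F]_x x%:E = mu%:E)%E.
Hypothesis iX2 : F.-integrable setT (fun x : R => ((x - mu) ^+ 2)%:E).
Hypothesis EX2 : (\int[F]_x ((x - mu) ^+ 2)%:E = s2%:E)%E.
Hypothesis EXq : (\int[F]_x (`|x| `^ q)%:E = m%:E)%E.
Hypothesis q0 : 0 < q.

Let mq : measurable_fun setT (fun x : R => (`|x| `^ q)%:E).
Proof.
apply/measurable_EFinP.
by apply: (measurableT_comp (measurable_powR q)); exact: normr_measurable.
Qed.

Lemma abs_moment_ge0 : 0 <= m.
Proof.
by rewrite -lee_fin -EXq; apply: integral_ge0 => x _; rewrite lee_fin powR_ge0.
Qed.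

(* When [mu < u], [x - mu] has nonpositive integral over [x <= u]: the dominating
   function [h] of the proof is at least [1] on [u < x], so that part of its
   integral offsets the missing mass [1 - c]. *)
Lemma truncated_mgf_le (th V p0 c u : R) :
    0 < th -> th * `|mu| <= 1 / 4 -> 0 <= V -> th * (u - mu) <= V ->
    0 < p0 -> (p0%:E <= F `]-oo, mu]%classic)%E ->
    0 < c -> F `]-oo, u]%classic = c%:E ->
  (\int[F]_(x in `]-oo, u]%classic) (expR (th * x))%:E <=
   (expR (th * mu) *
     (1 + (2 * th ^+ 2 * s2 + expR V * (4 * th) `^ q * m) / p0) * c)%:E)%E.
Proof.
move=> th0 thmu V0 thV p00 Fmu c0 Fu.
set B := (2 * th ^+ 2 * s2 + expR V * (4 * th) `^ q * m).
have B0 : 0 <= B.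
  have s20 : 0 <= s2 by exact: variance_ge0 EX2.
  by rewrite addr_ge0// !mulr_ge0 ?expR_ge0 ?powR_ge0 ?sqr_ge0 ?abs_moment_ge0 ?(ltW th0).
set D := [set` _] in Fu *.
have mD : measurable D by exact: measurable_itv.
have mDC : measurable (~` D) by exact: measurableC.
have me : measurable_fun setT (fun x : R => (expR (th * (x - mu)))%:E).
  apply/measurable_EFinP; apply: measurableT_comp => //.
  by apply: measurable_funM => //; exact: measurable_funB.
have -> : (\int[F]_(x in D) (expR (th * x))%:E =
    (expR (th * mu))%:E * \int[F]_(x in D) (expR (th * (x - mu)))%:E)%E.
  rewrite -ge0_integralZl_EFin ?expR_ge0//; last exact: measurable_funTS.
  apply: eq_integral => x _; rewrite -EFinM -expRD; congr (expR _)%:E; ring.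
rewrite -mulrA EFinM; apply: lee_wpmul2l; first by rewrite lee_fin expR_ge0.
(* For [u <= mu] the exponential is at most [1] on the domain, so the integral is at most [c]. *)
have [umu|muu] := leP u mu.
  apply: (@le_trans _ _ (\int[F]_(x in D) cst 1 x)%E); last first.
    rewrite (integral_cst F mD) Fu mul1e lee_fin ler_peMl ?(ltW c0)//.
    by rewrite lerDl divr_ge0// ltW.
  apply: ge0_le_integral => //.
  - exact: measurable_funTS.
  - move=> x; rewrite /D /= in_itv /= => xu; rewrite lee_fin -expR0 ler_expR.
    by rewrite pmulr_rle0//; lra.
pose h x := (1 + th * (x - mu) + 2 * th ^+ 2 * (x - mu) ^+ 2 +
    expR V * (4 * th) `^ q * (`|x| `^ q))%:E.
have hD x : D x -> ((expR (th * (x - mu)))%:E <= h x)%E.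
  rewrite /D /= in_itv /= => xu; rewrite lee_fin expR_trunc_le//.
  by apply: le_trans thV; rewrite ler_pM2l// lerD2r.
have hDC x : (~` D) x -> (1 <= h x)%E.
  rewrite /D /= in_itv /= => /negP; rewrite -ltNge => ux; rewrite lee_fin.
  have xmu : 0 <= x - mu by lra.
  rewrite -!addrA lerDl !addr_ge0 ?mulr_ge0 ?expR_ge0 ?powR_ge0 ?sqr_ge0//;
    exact: ltW.
have h0 : forall x, (0 <= h x)%E.
  move=> x; have [Dx|nDx] := pselect (D x).
    by apply: le_trans (hD x Dx); rewrite lee_fin expR_ge0.
  by apply: le_trans (hDC x nDx).
have iq : F.-integrable setT (fun x : R => (`|x| `^ q)%:E).
  apply/integrableP; split => //.
  rewrite (eq_integral (fun x : R => (`|x| `^ q)%:E)) ?EXq ?ltry// => x _.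
  by rewrite gee0_abs// lee_fin powR_ge0.
have iq' := integrableZl measurableT (expR V * (4 * th) `^ q) iq.
have iquad := integrable_quadratic F mu FT iX iX2 1 th (2 * th ^+ 2).
have hE : h = (fun x => (1 + th * (x - mu) + 2 * th ^+ 2 * (x - mu) ^+ 2)%:E +
    (expR V * (4 * th) `^ q)%:E * (`|x| `^ q)%:E)%E.
  by apply/funext => x; rewrite -EFinM -EFinD.
have mh : measurable_fun setT h.
  by rewrite hE; apply: (measurable_int F); exact: integrableD.
have Eh : (\int[F]_x h x = (1 + B)%:E)%E.
  rewrite hE integralD// (integral_quadratic F mu s2 FT iX EX iX2 EX2).
  rewrite integralZl// EXq -EFinM -EFinD; congr (_%:E); rewrite /B; ring.
have FDC : F (~` D) = (1 - c)%:E.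
  have FU : (F (D `|` ~` D) = c%:E + F (~` D))%E.
    by rewrite -Fu; apply: measureU => //; rewrite setICr.
  rewrite setUv FT in FU.
  by rewrite EFinB (FU : 1%:E = _) addeAC subee// add0e.
have split : (\int[F]_(x in D) (expR (th * (x - mu)))%:E + (1 - c)%:E <= (1 + B)%:E)%E.
  rewrite -Eh -(setUv D) ge0_integral_setU//; last 2 first.
  - by rewrite setUv.
  - by rewrite disj_set2E setICr.
  apply: leeD.
    apply: ge0_le_integral => //; exact: measurable_funTS.
  rewrite -FDC -[leLHS]mul1e -(integral_cst F mDC).
  by apply: ge0_le_integral => //; exact: measurable_funTS.
(* As [mu < u], [c] is at least the mass at or below [mu]. Hence [B <= B / p0 * c], with a
   correction [B / p0] that does not involve [c]. *)
have p0c : p0 <= c.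
  rewrite -lee_fin -Fu; apply: (le_trans Fmu); apply: le_measure; rewrite ?inE//.
  by move=> x; rewrite /D /= !in_itv /= => xmu; lra.
apply: (@le_trans _ _ (c + B)%:E).
  move: split; rewrite -leeBrDr// => hs; apply: (le_trans hs).
  by rewrite -EFinB lee_fin; lra.
rewrite lee_fin mulrDl mul1r lerD2l mulrAC ler_pdivlMr//.
by rewrite ler_wpM2l.
Qed.

End truncated_mgf.

(** * Regular variation, and the size of the Chernoff exponent *)

(** Doubling argument: eventually [G (2 * x) >= r * G x] for a fixed [r > 0], so once
    [2 ^+ m >= 1 / r] the quantity [G y * y ^+ m] does not decrease under doubling. Monotonicity of
    [G] handles the initial interval. *)
Lemma regularly_varying_ge_polynomial (R : realType) (G L : R -> R) (alpha : R) :
    (forall x y, x <= y -> G y <= G x) -> slowly_varying L ->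
    (forall x, 0 < x -> G x = L x * powR x (- alpha)) ->
  exists (m : nat) (c x0 : R), [/\ 0 < c, 0 < x0 &
    forall y, x0 <= y -> c <= G y * y ^+ m].
Proof.
move=> Gd [Lpos Lsv] GL.
have [b b0 b2] : exists2 b : R, 0 < b &
    forall x, b < x -> 0 < L x /\ 1 / 2 < L (2 * x) / L x.
  have h2 : \forall x \near +oo, 1 / 2 < L (2 * x) / L x.
    by apply: (cvgr_gt 1 (Lsv 2 _)) => //; lra.
  have [b [_ hb]] := filterI Lpos h2.
  exists (Num.max b 1); first by rewrite lt_max ltr01 orbT.
  by move=> x; rewrite gt_max => /andP[/hb].
pose x0 := b + 1.
have x00 : 0 < x0 by rewrite addr_gt0.
pose r : R := 1 / 2 * 2 `^ (- alpha).
have r0 : 0 < r by rewrite mulr_gt0 ?powR_gt0.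
have Gr x : x0 <= x -> r * G x <= G (2 * x) /\ 0 < G x.
  move=> x0x; have bx : b < x by rewrite /x0 in x0x; lra.
  have x_gt0 : 0 < x by apply: lt_trans bx.
  have [Lx L2x] := b2 _ bx.
  have px : 0 < x `^ (- alpha) by rewrite powR_gt0.
  rewrite !GL ?mulr_gt0// powRM ?(ltW x_gt0)//; split => //.
  have : 1 / 2 * L x <= L (2 * x) by apply: ltW; rewrite -ltr_pdivlMr.
  have p2 : 0 < (2 : R) `^ (- alpha) by rewrite powR_gt0.
  move=> h; rewrite /r.
  rewrite [leLHS](_ : _ = (1 / 2 * L x) * (2 `^ (- alpha) * x `^ (- alpha))); last by rewrite mulrACA.
  by rewrite [leRHS]mulrA [leLHS]mulrA !ler_wpM2r ?powR_ge0.
have [m rm] : exists m : nat, 1 <= r * 2 ^+ m.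
  exists (Num.truncn r^-1).+1; rewrite -ler_pdivrMl// mulr1; apply: ltW.
  apply: lt_le_trans (truncnS_gt _) _.
  by rewrite -natrX ler_nat ltnW// ltn_expl.
have step x : x0 <= x -> G x <= G (2 * x) * 2 ^+ m.
  move=> x0x; have [h Gx0] := Gr x x0x.
  apply: (@le_trans _ _ (r * G x * 2 ^+ m)); last by rewrite ler_pM2r ?exprn_gt0.
  by rewrite mulrAC ler_peMl// ltW.
exists m, (G (2 * x0) * x0 ^+ m), x0; split => //.
  rewrite mulr_gt0 ?exprn_gt0//.
  have x02 : x0 <= 2 * x0 by lra.
  by have [] := Gr _ x02.
(* Induction on the number [k] of halvings that bring [y] down to [[x0, 2 * x0]]. *)
suff H k y : x0 <= y -> y <= 2 ^+ k * x0 -> G (2 * x0) * x0 ^+ m <= G y * y ^+ m.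
  move=> y x0y; apply: (H (Num.truncn (y / x0)).+1) => //.
  rewrite -ler_pdivrMr//; apply: ltW; apply: lt_le_trans (truncnS_gt _) _.
  by rewrite -natrX ler_nat ltnW// ltn_expl.
have base y' : x0 <= y' -> y' <= 2 * x0 -> G (2 * x0) * x0 ^+ m <= G y' * y' ^+ m.
  move=> x0y y2; apply: ler_pM; rewrite ?exprn_ge0 ?(ltW x00)//.
  - have x02 : x0 <= 2 * x0 by lra.
    by have [_ /ltW] := Gr _ x02.
  - exact: Gd.
  - by rewrite lerXn2r ?nnegrE ?(ltW x00)//; lra.
elim: k y => [|k IH] y x0y yk.
  by apply: base => //; rewrite expr0 in yk; lra.
have [y2|y2] := leP y (2 * x0); first exact: base.
have -> : G y * y ^+ m = G (2 * (y / 2)) * 2 ^+ m * (y / 2) ^+ m.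
  by rewrite -mulrA -exprMn (_ : 2 * (y / 2) = y)//; field.
apply: (@le_trans _ _ (G (y / 2) * (y / 2) ^+ m)).
  by apply: IH; rewrite ?exprS in yk *; lra.
by apply: ler_wpM2r; [rewrite exprn_ge0//; lra|apply: step; lra].
Qed.

(* [4 * A / eta = 8 * A * (2 + delta) / delta] for [eta = delta / (2 * (2 + delta))],
   the exponent in the estimate [ln x <= x^eta / eta]. *)
Lemma chernoff_exponent_le (R : realType) (s2 mq p0 delta A C M x : R) (n : nat) :
    let K := (8 * A * (2 + delta) / delta) `^ (2 + delta) in
    let a := ln n%:R in
    let th := A * ln x / x in
    0 <= s2 -> 0 <= mq -> 0 < p0 -> 0 < delta -> 0 < A -> 0 < C ->
    1 <= M -> 1 <= a -> 8 * A ^+ 2 * s2 / p0 <= M ->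
    4 * A * C / delta <= Num.sqrt a -> 4 * K * mq / p0 <= a ->
    M * Num.sqrt (n%:R * a) <= x ->
  n%:R * ((2 * th ^+ 2 * s2 +
    expR (A * C * ln x / Num.sqrt a) * (4 * th) `^ (2 + delta) * mq) / p0) <= ln x.
Proof.
move=> K a th s20 mq0 p00 d0 A0 C0 M1 a1 hM hC hK hx.
set N : R := n%:R.
have aE : a = ln N by [].
have N1 : 1 <= N.
  rewrite leNgt; apply/negP => /ltW /ln_le0; rewrite -aE; lra.
have N0 : 0 < N by apply: lt_le_trans N1.
have a0 : 0 < a by apply: lt_le_trans a1.
have sN : 0 < Num.sqrt N by rewrite sqrtr_gt0.
have sa : 0 < Num.sqrt a by rewrite sqrtr_gt0.
have sa1 : 1 <= Num.sqrt a by rewrite -[leLHS]sqrtr1 ler_wsqrtr.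
have sN2 : Num.sqrt N ^+ 2 = N by rewrite sqr_sqrtr ?ltW.
have sa2 : Num.sqrt a ^+ 2 = a by rewrite sqr_sqrtr ?ltW.
(* The factorisation [x = sqrt N * w] splits [ln x] into [ln w + a / 2], where both [M * ln w] and
   [M * a] are at most [w ^+ 2]. *)
pose w := x / Num.sqrt N.
have M0 : 0 < M by apply: lt_le_trans M1.
have wM : M * Num.sqrt a <= w.
  rewrite ler_pdivlMr//; apply: le_trans hx.
  by rewrite sqrtrM ?(ltW N0)// mulrA mulrAC.
have w1 : M <= w by apply: le_trans wM; rewrite ler_peMr ?(ltW M0).
have w0 : 0 < w by apply: lt_le_trans w1.
have xE : x = Num.sqrt N * w by rewrite /w mulrC divfK ?gt_eqF.
have x0 : 0 < x by rewrite xE mulr_gt0.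
set l := ln x.
have thl : th = A * l / x by [].
have lE : l = ln w + a / 2.
  rewrite /l xE lnM ?posrE// addrC; congr (_ + _).
  by rewrite aE -[in RHS]sN2 lnXn// mulr2n; lra.
have lnw : ln w <= w by apply: ltW; exact: ln_sublinear.
have lnw0 : 0 <= ln w by apply: ln_ge0; lra.
have la : a / 2 <= l by lra.
have l0 : 0 < l by lra.
have eN : N <= expR (2 * l).
  rewrite (_ : 2 * l = a + 2 * ln w); last by rewrite lE; field.
  by rewrite expRD aE lnK ?posrE// ler_peMr ?(ltW N0)// -expR0 ler_expR mulr_ge0.
have Nl : N * l / x ^+ 2 <= 2 / M.
  rewrite xE exprMn sN2 lE.
  rewrite [leLHS](_ : _ = (ln w + a / 2) / w ^+ 2); last first.
    by field; rewrite !gt_eqF.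
  rewrite ler_pdivrMr ?exprn_gt0// mulrAC ler_pdivlMr//.
  have : M * ln w <= w ^+ 2 by rewrite expr2 ler_pM ?(ltW M0).
  have : M * a <= w ^+ 2.
    apply: (@le_trans _ _ ((M * Num.sqrt a) ^+ 2)).
      rewrite exprMn sa2 ler_pM2r// expr2 ler_peMl//; exact: ltW.
    rewrite lerXn2r ?nnegrE ?(ltW w0)// mulr_ge0 ?ltW//.
  by have := sqr_ge0 w; lra.
(* The variance term takes half of the allowance [l]; the moment term takes the other half. *)
have T1 : N * (2 * th ^+ 2 * s2) <= l / 2 * p0.
  rewrite [leLHS](_ : _ = 2 * A ^+ 2 * s2 * l * (N * l / x ^+ 2)); last first.
    by rewrite thl; field; rewrite gt_eqF.
  apply: (@le_trans _ _ (2 * A ^+ 2 * s2 * l * (2 / M))).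
    by apply: ler_wpM2l => //; rewrite !mulr_ge0 ?sqr_ge0// ltW.
  rewrite mulrA ler_pdivrMr//.
  move: hM; rewrite ler_pdivrMr// => hM.
  have := ler_wpM2r (ltW l0) hM; lra.
have thE : th = A * l * expR (- l) by rewrite thl expRN lnK ?posrE.
pose q := 2 + delta.
have q0 : 0 < q by rewrite addr_gt0.
(* With this [eta], [(eta - 1) * q = - 2 - delta / 2]: the [- 2] cancels [N <= expR (2 * l)], and
   half of the surplus [delta / 2] absorbs the truncation factor, whose exponent is at most
   [delta / 4 * l]. *)
pose eta := delta / (2 * q).
have eta0 : 0 < eta by rewrite divr_gt0 ?mulr_gt0.
have th4 : 4 * th <= 4 * A / eta * expR ((eta - 1) * l).
  rewrite thE mulrBl mul1r expRD.
  have : eta * l <= expR (eta * l) by have := expR_ge1Dx (eta * l); lra.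
  move=> h.
  have h' : l <= expR (eta * l) / eta by rewrite ler_pdivlMr// mulrC.
  have := ler_wpM2r (expR_ge0 (- l)) h'.
  have e0 := expR_ge0 (- l).
  set X := l * expR (- l); set Y := expR (eta * l) / eta * expR (- l) => XY.
  rewrite [leLHS](_ : _ = 4 * A * X); last by rewrite /X; ring.
  rewrite [leRHS](_ : _ = 4 * A * Y); last by rewrite /Y; field; rewrite gt_eqF.
  by rewrite ler_pM2l// mulr_gt0.
have th0 : 0 <= 4 * th by rewrite mulr_ge0// thl divr_ge0 ?mulr_ge0 ?ltW.
have A4 : 0 < 4 * A / eta by rewrite divr_gt0// mulr_gt0.
have T2 : N * (expR (A * C * l / Num.sqrt a) * (4 * th) `^ q) <= K.
  have hq : (4 * th) `^ q <= K * expR (((eta - 1) * l) * q).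
    apply: (le_trans (ge0_ler_powR (ltW q0) _ _ th4)); rewrite ?nnegrE//.
      by rewrite mulr_ge0 ?expR_ge0 ?(ltW A4).
    rewrite powRM ?expR_ge0 ?(ltW A4)// -expRM.
    rewrite (_ : 4 * A / eta = 8 * A * (2 + delta) / delta)//.
    by rewrite /eta /q; field; rewrite !gt_eqF.
  have hV : A * C * l / Num.sqrt a <= delta / 4 * l.
    rewrite ler_pdivrMr//; move: hC; rewrite ler_pdivrMr// => hC.
    by have := ler_wpM2r (ltW l0) hC; lra.
  have K0 : 0 <= K by rewrite powR_ge0.
  apply: (@le_trans _ _ (expR (2 * l) * (expR (delta / 4 * l) *
      (K * expR (((eta - 1) * l) * q))))).
    rewrite ler_pM ?mulr_ge0 ?expR_ge0 ?powR_ge0 ?(ltW N0)//.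
    by rewrite ler_pM ?expR_ge0 ?powR_ge0// ler_expR.
  rewrite [leLHS](_ : _ = K * (expR (2 * l) * (expR (delta / 4 * l) *
      expR (((eta - 1) * l) * q)))); last by ring.
  rewrite ler_piMr// -!expRD -[leRHS]expR0 ler_expR.
  rewrite [leLHS](_ : _ = - (delta / 4 * l)); last first.
    by rewrite /eta /q; field; rewrite gt_eqF.
  by rewrite oppr_le0 mulr_ge0// ?divr_ge0// ltW.
rewrite mulrA ler_pdivrMr// mulrDr.
have : N * (expR (A * C * l / Num.sqrt a) * (4 * th) `^ q * mq) <= l / 2 * p0.
  rewrite mulrA; apply: (le_trans (ler_wpM2r mq0 T2)).
  move: hK; rewrite ler_pdivrMr// => hK.
  have := ler_wpM2r (ltW p00) la; lra.
by rewrite -/q; lra.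
Qed.

(** * Bounds on the two tail probabilities *)

Section laws.
Context {R : realType} (F : {measure set R -> \bar R}).
Hypotheses (FT : F setT = 1%E).

Lemma measure_le1 (D : set R) : measurable D -> (F D <= 1)%E.
Proof. by move=> mD; rewrite -FT; apply: le_measure; rewrite ?inE. Qed.

Lemma distrFE u : F `]-oo, u]%classic = (distrF F u)%:E.
Proof.
rewrite /distrF fineK// fin_numE -ltNye -ltey.
rewrite (lt_le_trans _ (measure_ge0 _ _)) ?ltNyr//=.
by rewrite (le_lt_trans (measure_le1 _ _)) ?ltry//; exact: measurable_itv.
Qed.

Lemma tailFE t : F `]t, +oo[%classic = (tailF F t)%:E.
Proof.
rewrite /tailF -setCitvl.
have mD : measurable (`]-oo, t]%classic : set R) by exact: measurable_itv.
have FU : F (`]-oo, t]%classic `|` ~` `]-oo, t]%classic) =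
    ((distrF F t)%:E + F (~` `]-oo, t]%classic))%E.
  rewrite -distrFE; apply: measureU => //; last by rewrite setICr.
  exact: measurableC.
rewrite setUv FT in FU.
by rewrite EFinB (FU : 1%:E = _) addeAC subee// add0e.
Qed.

Lemma tailF_nonincreasing x y : x <= y -> tailF F y <= tailF F x.
Proof.
move=> xy; rewrite -lee_fin -!tailFE; apply: le_measure; rewrite ?inE//.
by move=> z; rewrite /= !in_itv /= !andbT => yz; lra.
Qed.

Variables (mu s2 delta mq : R).
Hypothesis iX : F.-integrable setT (fun x : R => x%:E).
Hypothesis EX : (\int[F]_x x%:E = mu%:E)%E.
Hypothesis iX2 : F.-integrable setT (fun x : R => ((x - mu) ^+ 2)%:E).
Hypothesis EX2 : (\int[F]_x ((x - mu) ^+ 2)%:E = s2%:E)%E.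
Hypothesis EXq : (\int[F]_x (`|x| `^ (2 + delta))%:E = mq%:E)%E.
Hypothesis delta0 : 0 < delta.

(** One big jump with slack [y = x]: of the [n.+1] means in [g], [n] cancel, leaving the threshold
    [mu + 2 * x], and the variance condition makes the Chebyshev factor at least [1 / 2]. *)
Lemma ptilde_ge (g x : R) n : g = n.+1%:R * mu + x -> 0 < x ->
  2 * n%:R * s2 <= x ^+ 2 -> tailF F (mu + 2 * x) / 2 <= ptilde F g n.+1.
Proof.
move=> gE x0 nx; rewrite -lee_fin /ptilde fineK; last first.
  by apply: tailI_fin_num => //; rewrite FT.
have s20 : 0 <= s2 by exact: variance_ge0 EX2.
have ns2 : 0 <= n%:R * s2 by rewrite mulr_ge0.
have x20 : 0 < x ^+ 2 by rewrite exprn_gt0.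
apply: le_trans (tailI_ge_one_big_jump F mu s2 FT iX EX iX2 EX2 g x n x0 _); last by lra.
have -> : g - n%:R * mu + x = mu + 2 * x by rewrite gE -natr1; ring.
rewrite tailFE -EFinM lee_fin mulrC ler_wpM2r//.
  by rewrite -lee_fin -tailFE measure_ge0.
rewrite lerBrDl -lerBrDr ler_pdivrMr//; lra.
Qed.

Lemma ptilde_trunc_ge0 (u g : R) n : 0 <= ptilde_trunc F u g n.
Proof.
rewrite /ptilde_trunc fine_ge0//; elim: n (0 : R) => [|n IH] s /=.
  by case: ifP; rewrite lee_fin.
apply: mule_ge0; first by rewrite lee_fin invr_ge0 fine_ge0.
by apply: integral_ge0 => x _; exact: IH.
Qed.

(** The Markov bound with the truncated exponential moment, followed by
    [(1 + B)^n <= expR (n B)]. *)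
Lemma ptilde_trunc_le (u g th V p0 : R) n :
    0 < th -> th * `|mu| <= 1 / 4 -> 0 <= V -> th * (u - mu) <= V ->
    0 < p0 -> (p0%:E <= F `]-oo, mu]%classic)%E -> 0 < distrF F u ->
  ptilde_trunc F u g n <= expR (- (th * (g - n%:R * mu)) + n%:R *
    ((2 * th ^+ 2 * s2 + expR V * (4 * th) `^ (2 + delta) * mq) / p0)).
Proof.
move=> th0 thmu V0 thV p00 Fmu Fu; set B := _ / p0.
have q0 : 0 < 2 + delta by rewrite addr_gt0.
have B0 : 0 <= B.
  have s20 : 0 <= s2 by exact: variance_ge0 EX2.
  have mq0 : 0 <= mq by exact: abs_moment_ge0 EXq.
  by rewrite divr_ge0 ?(ltW p00)// addr_ge0// !mulr_ge0 ?expR_ge0 ?powR_ge0 ?(ltW th0).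
have mD : measurable (`]-oo, u]%classic : set R) by exact: measurable_itv.
have mgf := truncated_mgf_le F mu s2 _ mq FT iX EX iX2 EX2 EXq q0 _ _ _ _ u
  th0 thmu V0 thV p00 Fmu Fu (distrFE u).
have M0 : 0 <= expR (th * mu) * (1 + B) by rewrite mulr_ge0 ?expR_ge0// addr_ge0.
have := tailI_le_expR F _ _ g mD Fu (distrFE u) th _ th0 M0 mgf n 0.
rewrite -lee_fin /ptilde_trunc fineK; last first.
  exact: tailI_fin_num mD Fu (distrFE u) _ _.
move=> /le_trans; apply; rewrite lee_fin exprMn mulrA -expRM_natl -expRD.
have -> : - (th * (g - n%:R * mu)) + n%:R * B =
  th * (0 - g) + n%:R * (th * mu) + n%:R * B by ring.
rewrite [leRHS]expRD ler_pM2l ?expR_gt0// expRM_natl.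
rewrite lerXn2r ?nnegrE ?addr_ge0 ?expR_ge0//; exact: expR_ge1Dx.
Qed.

End laws.

(** Domination by [(x - mu)^2 <= 2 x^2 + 2 mu^2] and [x^2 <= 1 + |x|^(2 + delta)]. *)
Lemma integrable_sqr_sub (R : realType) (F : {measure set R -> \bar R}) (mu delta : R) :
    F setT = 1%E -> 0 < delta ->
    (\int[F]_x (`|x| `^ (2 + delta))%:E < +oo)%E ->
  F.-integrable setT (fun x : R => ((x - mu) ^+ 2)%:E).
Proof.
move=> FT d0 hq.
have mq : measurable_fun setT (fun x : R => (`|x| `^ (2 + delta))%:E).
  apply/measurable_EFinP.
  by apply: (measurableT_comp (measurable_powR _)); exact: normr_measurable.
have iq : F.-integrable setT (fun x : R => (`|x| `^ (2 + delta))%:E).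
  apply/integrableP; split => //.
  rewrite (eq_integral (fun x : R => (`|x| `^ (2 + delta))%:E))// => x _.
  by rewrite gee0_abs// lee_fin powR_ge0.
have i1 := integrable_cstT F FT (2 + 2 * mu ^+ 2).
have i2 := integrableZl measurableT 2 iq.
apply: le_integrable (integrableD measurableT i1 i2) => //.
  apply/measurable_EFinP; apply: measurable_funX; exact: measurable_funB.
move=> x _; rewrite -EFinM -EFinD !abse_EFin lee_fin.
rewrite ger0_norm ?sqr_ge0//; apply: le_trans (ler_norm _).
have hx : x ^+ 2 <= 1 + `|x| `^ (2 + delta).
  rewrite -real_normK ?num_real//.
  have [x1|x1] := leP `|x| 1.
    apply: (@le_trans _ _ 1); last by rewrite lerDl powR_ge0.
    by rewrite exprn_ile1.
  apply: (@le_trans _ _ (`|x| `^ (2 + delta))); last by rewrite lerDr.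
  rewrite -powR_mulrn// ler_powR ?(ltW x1)//; lra.
have := sqr_ge0 (x + mu); lra.
Qed.

(** * Comparison of the bounds and passage to the limit *)

(** The constants are fixed before [n], [g] and [u], which turns the asymptotic hypotheses into
    plain thresholds. The ratio is [O (1 / x)], and [ln n <= x]. *)
Lemma ptilde_trunc_le_ptilde (R : realType) (F : {measure set R -> \bar R})
    (mu alpha C : R) (FT : F setT = 1%E)
    (iX : F.-integrable setT (fun x : R => x%:E))
    (EX : (\int[F]_x x%:E)%E = mu%:E)
    (hreg : exists L : R -> R, slowly_varying L /\
      forall x : R, 0 < x -> tailF F x = L x * powR x (- alpha))
    (hmom : exists delta : R, 0 < delta /\
      (\int[F]_x (powR `|x| (2 + delta))%:E < +oo)%E) : 0 < C ->
  exists K M T : R, forall (n : nat) (g u : R),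
    let x := g - n%:R * mu in
    T <= ln n%:R -> M * Num.sqrt (n%:R * ln n%:R) <= x ->
    u <= mu + C * (x / Num.sqrt (ln n%:R)) -> 0 < distrF F u ->
    0 < ptilde F g n /\ ptilde_trunc F u g n <= K / ln n%:R * ptilde F g n.
Proof.
move=> C0; have [delta [d0 hq]] := hmom.
have [L [Lsv GL]] := hreg.
have [m [c [x0 [c0 x00 hc]]]] :=
  regularly_varying_ge_polynomial _ _ _ _ (tailF_nonincreasing F FT) Lsv GL.
have iX2 := integrable_sqr_sub _ F mu _ FT d0 hq.
have [s2 EX2] : exists s2 : R, (\int[F]_x ((x - mu) ^+ 2)%:E = s2%:E)%E.
  by exists (fine (\int[F]_x ((x - mu) ^+ 2)%:E)); rewrite fineK// integrable_fin_num.
have [mq EXq] : exists mq : R, (\int[F]_x (`|x| `^ (2 + delta))%:E = mq%:E)%E.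
  exists (fine (\int[F]_x (`|x| `^ (2 + delta))%:E)); rewrite fineK//.
  by rewrite ge0_fin_numE//; apply: integral_ge0 => x _; rewrite lee_fin powR_ge0.
have s20 : 0 <= s2 by exact: variance_ge0 EX2.
have mq0 : 0 <= mq by exact: abs_moment_ge0 EXq.
have tailF0 y : 0 < tailF F y.
  pose z := Num.max y x0; have z0 : 0 < z by rewrite lt_max x00 orbT.
  apply: lt_le_trans (_ : tailF F z <= _); last first.
    by apply: tailF_nonincreasing => //; rewrite le_max lexx.
  have : 0 < tailF F z * z ^+ m.
    by apply: lt_le_trans c0 (hc _ _); rewrite le_max lexx orbT.
  by rewrite pmulr_lgt0// exprn_gt0.
have p00 : 0 < distrF F mu.
  rewrite -lte_fin -distrFE//; apply: (below_mean_gt0 F mu s2 FT iX EX iX2 EX2).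
  by rewrite tailFE// lte_fin.
pose p0 := distrF F mu; rewrite -/p0 in p00.
(* One unit of [A] pays for [n B <= ln x]; the remaining [m.+1] give [x ^- m.+1], one power better
   than the lower bound. *)
pose A : R := m.+2%:R; have A0 : 0 < A by rewrite ltr0n.
pose K := (8 * A * (2 + delta) / delta) `^ (2 + delta).
have K0 : 0 <= K by rewrite powR_ge0.
pose M1 := 8 * A ^+ 2 * s2 / p0.
have M10 : 0 <= M1.
  by rewrite /M1 divr_ge0 ?(ltW p00)// !mulr_ge0 ?(ltW A0).
pose T1 := 4 * A * C / delta.
pose T2 := 4 * K * mq / p0.
have T20 : 0 <= T2 by rewrite /T2 divr_ge0 ?(ltW p00)// !mulr_ge0.
pose T3 := 16 * A * `|mu|.
have T30 : 0 <= T3 by rewrite /T3 !mulr_ge0 ?(ltW A0).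
(* The first constant comes from [tailF (3 * x) / 2]. In the second, [M1] serves the variance term
   and [2 * s2] Chebyshev. In the third, [T1 ^+ 2] controls the truncation factor, [T2] the moment
   term, [T3] gives [th * |mu| <= 1 / 4], and the last two give [mu + 2 * x <= 3 * x] and
   [x0 <= 3 * x]. *)
exists (2 * 3 ^+ m / c), (1 + M1 + 2 * s2).
exists (1 + T1 ^+ 2 + T2 + T3 + `|mu| + x0) => n g u x.
have T3E : T3 = 16 * A * `|mu| by [].
have nmu := normr_ge0 mu; have T10 := sqr_ge0 T1.
set M := 1 + M1 + 2 * s2.
have M1le : 1 <= M by rewrite /M; lra.
set a := ln n%:R => Ta Mx ux Fu.
have a1 : 1 <= a by lra.
have a0 : 0 < a by lra.
have n1 : 1 <= n%:R :> R.
  by rewrite leNgt; apply/negP => /ltW /ln_le0; rewrite -/a; lra.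
have n0 : 0 < n%:R :> R by lra.
have an : a <= n%:R by apply: ltW; exact: ln_sublinear.
have sx : Num.sqrt (n%:R * a) <= x.
  by apply: le_trans Mx; rewrite ler_peMl// sqrtr_ge0.
have ax : a <= x.
  apply: le_trans sx; rewrite -[leLHS](ger0_norm (ltW a0)) -sqrtr_sqr ler_wsqrtr//.
  by rewrite expr2 ler_pM2r.
have xp : 0 < x by lra.
have Mx2 : M * n%:R <= x ^+ 2.
  apply: (@le_trans _ _ ((M * Num.sqrt (n%:R * a)) ^+ 2)).
    rewrite exprMn sqr_sqrtr ?mulr_ge0 ?(ltW a0) ?(ltW n0)//.
    rewrite mulrA [M ^+ 2]expr2.
    have M0 : 0 < M by lra.
    have h1 : M * n%:R <= M * M * n%:R.
      by rewrite ler_pM2r// ler_peMl// ltW.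
    by apply: (le_trans h1); rewrite ler_peMr// !mulr_ge0 ?(ltW M0).
  by rewrite lerXn2r ?nnegrE ?(ltW xp)// mulr_ge0 ?sqrtr_ge0//; lra.
set l := ln x.
have xE : expR l = x by rewrite /l lnK ?posrE.
have la : a / 2 <= l.
  have : a <= ln (x ^+ 2).
    rewrite ler_ln ?posrE ?exprn_gt0//; apply: le_trans Mx2.
    by rewrite ler_peMl// ltW.
  by rewrite lnXn// -/l mulr2n; lra.
have l0 : 0 < l by lra.
pose th := A * l / x.
have th0 : 0 < th by rewrite divr_gt0 ?mulr_gt0.
have thx : th * x = A * l by rewrite /th divfK ?gt_eqF.
(* [x = expR l] is at least [1 + l^2 / 2], while [T3] gives [A * l * |mu| <= l^2 / 8]. *)
have thmu : th * `|mu| <= 1 / 4.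
  rewrite /th mulrAC ler_pdivrMr//.
  have h1 : 1 + l ^+ 2 / 2 <= x by rewrite -xE; have := expR_ge1Dxn 1 (ltW l0).
  have h2 : 8 * A * `|mu| <= l by rewrite T3E in Ta; lra.
  by have := ler_wpM2r (ltW l0) h2; rewrite -expr2; lra.
have sa : 0 < Num.sqrt a by rewrite sqrtr_gt0.
pose V := A * C * l / Num.sqrt a.
have V0 : 0 <= V.
  by rewrite /V divr_ge0 ?(ltW sa)// !mulr_ge0 ?(ltW A0) ?(ltW C0) ?(ltW l0).
have thV : th * (u - mu) <= V.
  have -> : V = th * (C * (x / Num.sqrt a)).
    by rewrite /V /th; field; rewrite !gt_eqF.
  by rewrite ler_pM2l// lerBlDl.
have p0F : (p0%:E <= F `]-oo, mu]%classic)%E by rewrite distrFE.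
have hB := chernoff_exponent_le _ s2 mq p0 delta A C M x n s20 mq0 p00 d0 A0 C0.
have {}hB := hB M1le a1.
have T1s : T1 <= Num.sqrt a.
  have [T1n|T1p] := ltP T1 0; first by apply: ltW; apply: lt_trans sa.
  rewrite -[leLHS](ger0_norm T1p) -sqrtr_sqr ler_wsqrtr//; lra.
have {}hB := hB _ T1s.
have M1M : M1 <= M by rewrite /M; lra.
have T2a : T2 <= a by lra.
have {}hB := hB M1M T2a Mx.
have up : ptilde_trunc F u g n <= (x ^+ m.+1)^-1.
  apply: (le_trans (ptilde_trunc_le F FT mu s2 delta mq iX EX iX2 EX2 EXq d0
    u g th V p0 n th0 thmu V0 thV p00 p0F Fu)).
  rewrite -/x thx -xE -expRM_natl -expRN ler_expR.
  move: hB; rewrite -/a -/l -/th -/V => hB.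
  have : m.+1%:R + 1 = A by rewrite /A natr1.
  move=> AE; rewrite -AE mulrDl mul1r; lra.
have nE : n = n.-1.+1 by rewrite prednK// -(ltr0n R).
have low : tailF F (3 * x) / 2 <= ptilde F g n.
  apply: (@le_trans _ _ (tailF F (mu + 2 * x) / 2)).
    rewrite ler_pM2r ?invr_gt0//; apply: tailF_nonincreasing => //.
    have := ler_norm mu; lra.
  rewrite nE; apply: (ptilde_ge F FT mu s2 iX EX iX2 EX2) => //.
    by rewrite -nE /x addrC subrK.
  have : n.-1%:R <= n%:R :> R by rewrite ler_nat leq_pred.
  move=> h; have h1 := ler_wpM2r s20 h.
  have h2 : 2 * s2 * n%:R <= M * n%:R by rewrite ler_pM2r// /M; lra.
  by lra.
have P0 : 0 < ptilde F g n by apply: lt_le_trans low; rewrite divr_gt0.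
split => //; apply: (le_trans up).
have xm : 0 < x ^+ m by rewrite exprn_gt0.
have cP : c <= 2 * 3 ^+ m * ptilde F g n * x ^+ m.
  have x03 : x0 <= 3 * x by lra.
  apply: (le_trans (hc _ x03)); rewrite exprMn.
  have := ler_wpM2r (mulr_ge0 (exprn_ge0 m (ler0n R 3)) (ltW xm)) low.
  by lra.
rewrite exprS invfM.
rewrite [leRHS](_ : _ = a^-1 * (2 * 3 ^+ m / c * ptilde F g n)); last first.
  by rewrite mulrAC mulrC.
apply: ler_pM; rewrite ?invr_ge0 ?(ltW xp) ?(ltW xm)//.
  by rewrite lef_pV2 ?posrE.
rewrite -[leLHS]div1r ler_pdivrMr//.
rewrite [leRHS](_ : _ = 2 * 3 ^+ m * ptilde F g n * x ^+ m / c).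
  by rewrite ler_pdivlMr// mul1r.
by rewrite !(mulrAC _ _ c^-1).
Qed.

Lemma ptilde_trunc_subr_equiv (R : realType) (F : {measure set R -> \bar R})
    (FT : F setT = 1%E) (mu : R)
    (iX : F.-integrable setT (fun x : R => x%:E))
    (EX : (\int[F]_x x%:E)%E = mu%:E) (alpha : R)
    (hreg : exists L : R -> R, slowly_varying L /\
      forall x : R, 0 < x -> tailF F x = L x * powR x (- alpha))
    (hmom : exists delta : R, 0 < delta /\
      (\int[F]_x (powR `|x| (2 + delta))%:E < +oo)%E)
    (gamma u : nat -> R)
    (hgamma : (fun n : nat => (gamma n - n%:R * mu) / Num.sqrt (n%:R * ln n%:R))
                @ \oo --> +oo)
    (hu : exists C : R, \forall n \near \oo,
        u n <= mu + C * ((gamma n - n%:R * mu) / Num.sqrt (ln n%:R)))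
    (hupos : \forall n \near \oo, 0 < distrF F (u n)) :
  exists e : nat -> R, e @ \oo --> (0 : R) /\
    \forall n \near \oo,
      ptilde_trunc F (u n) (gamma n) n - ptilde F (gamma n) n
        = - ptilde F (gamma n) n * (1 + e n).
Proof.
have [C hC] := hu.
(* [C] may be nonpositive; enlarging it weakens the bound on [u n], since [gamma n - n mu] is
   eventually nonnegative. *)
have C1 : 0 < `|C| + 1 by rewrite ltr_pwDr.
have [K [M [T H]]] := ptilde_trunc_le_ptilde _ F mu alpha _ FT iX EX hreg hmom C1.
have lnge (A : R) : \forall n \near \oo, A <= ln n%:R :> R.
  near=> n; rewrite -[leLHS]expRK ler_ln ?posrE ?expR_gt0//.
    by near: n; exact: nbhs_infty_ger.
  apply: (@lt_le_trans _ _ (expR A)); first exact: expR_gt0.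
  by near: n; exact: nbhs_infty_ger.
have main : \forall n \near \oo, 0 < ptilde F (gamma n) n /\
    ptilde_trunc F (u n) (gamma n) n <= K / ln n%:R * ptilde F (gamma n) n.
  near=> n.
  have l1 : 1 <= ln n%:R :> R by near: n; exact: lnge.
  have n0 : 0 < n%:R :> R.
    by rewrite ltNge; apply/negP => /ln0; lra.
  have s0 : 0 < Num.sqrt (n%:R * ln n%:R : R).
    by rewrite sqrtr_gt0 mulr_gt0//; lra.
  have g0 : 0 <= gamma n - n%:R * mu.
    have : 0 <= (gamma n - n%:R * mu) / Num.sqrt (n%:R * ln n%:R).
      by near: n; exact: cvgry_ge.
    by rewrite pmulr_lge0// invr_gt0.
  apply: H.
  - by near: n; exact: lnge.
  - by rewrite -ler_pdivlMr//; near: n; exact: cvgry_ge.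
  - apply: (@le_trans _ _ (mu + C * ((gamma n - n%:R * mu) / Num.sqrt (ln n%:R)))).
      by near: n; exact: hC.
    rewrite lerD2l ler_wpM2r ?divr_ge0 ?sqrtr_ge0//.
    by have := ler_norm C; lra.
  - by near: n; exact: hupos.
(* The error is minus the ratio of the two probabilities, which lies between [0] and [K / ln n]. *)
exists (fun n => - (ptilde_trunc F (u n) (gamma n) n / ptilde F (gamma n) n)).
split; last first.
  near=> n.
  have [P0 _] : 0 < ptilde F (gamma n) n /\
    ptilde_trunc F (u n) (gamma n) n <= K / ln n%:R * ptilde F (gamma n) n.
    by near: n; exact: main.
  by field; rewrite gt_eqF.
apply/cvgrPdist_le => eps eps0; near=> n.
have [P0 hP] : 0 < ptilde F (gamma n) n /\
    ptilde_trunc F (u n) (gamma n) n <= K / ln n%:R * ptilde F (gamma n) n.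
  by near: n; exact: main.
have l1 : 1 <= ln n%:R :> R by near: n; exact: lnge.
rewrite sub0r opprK ger0_norm; last first.
  by rewrite divr_ge0 ?(ltW P0) ?ptilde_trunc_ge0.
rewrite ler_pdivrMr//; apply: (le_trans hP); rewrite ler_pM2r//.
rewrite ler_pdivrMr; last by lra.
by rewrite mulrC -ler_pdivrMr//; near: n; exact: lnge.
Unshelve. all: by end_near.
Qed.

Theorem theorem4 (R : realType) (F : probability R R)
  (* F has a density w.r.t. Lebesgue measure *)
  (hdens : exists f : R -> R, (forall x, 0 <= f x) /\ measurable_fun setT f /\
      forall A : set R, measurable A ->
        F A = (\int[lebesgue_measure]_(x in A) (f x)%:E)%E)
  (mu : R)
  (hmean_int : F.-integrable setT (fun x : R => x%:E))
  (hmean : (\int[F]_x x%:E)%E = mu%:E)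
  (alpha : R) (halpha : 2 < alpha)
  (hreg : exists L : R -> R, slowly_varying L /\
      forall x : R, 0 < x -> tailF F x = L x * powR x (- alpha))
  (hmom : exists delta : R, 0 < delta /\
      (\int[F]_x (powR `|x| (2 + delta))%:E < +oo)%E)
  (gamma u : nat -> R)
  (hgamma : (fun n : nat => (gamma n - n%:R * mu) / Num.sqrt (n%:R * ln n%:R))
              @ \oo --> +oo)
  (hu : exists C : R, \forall n \near \oo,
      u n <= mu + C * ((gamma n - n%:R * mu) / Num.sqrt (ln n%:R)))
  (* well-definedness of the truncated law tilde F_u *)
  (hupos : \forall n \near \oo, 0 < distrF F (u n)) :
  exists e : nat -> R, e @ \oo --> (0 : R) /\
    \forall n \near \oo,
      ptilde_trunc F (u n) (gamma n) n - ptilde F (gamma n) n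
        = - ptilde F (gamma n) n * (1 + e n).
Proof.
exact: (ptilde_trunc_subr_equiv R F (probability_setT F) mu hmean_int hmean alpha
  hreg hmom gamma u hgamma hu hupos).
Qed.
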